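(* Let $1\le i<j\le m$. For all sufficiently large positive integers $q$, the number $|M((\mathcal{B}_m^{\{x_i+x_j=0\}})_q)|$ of points $(x_1,\dots,x_m)\in\mathbb{Z}_q^m$ with $x_i+x_j=0$ that lie on no hyperplane $H'_q$ with $H'\in\mathcal{B}_m\setminus\{\{x_i+x_j=0\}\}$ equals $$\begin{cases}(q-2m)^{m-j}(q-2m+1)^{j-i}\big((q-2m+2)^{i-1}-(q-2m+1)^{i-2}\big) & \text{if } q \text{ is odd},\\ (q-2m)^{m-j+1}(q-2m+1)^{j-i-1}(q-2m+2)^{i-1} & \text{if } q \text{ is even}.\end{cases}$$
   Context: For $m\ge1$, the Shi arrangement of type B is the set of affine hyperplanes in $\mathbb{R}^m$ $$\mathcal{B}_m=\{\{x_s=0\},\{x_s=1\}\mid s\in[m]\}\cup\{\{x_s\pm x_t=0\},\{x_s\pm x_t=1\}\mid 1\le s<t\le m\},$$ where $[m]=\{1,\dots,m\}$. For a positive integer $q$ and a hyperplane $H=\{a_1x_1+\dots+a_mx_m=b\}$ with integer coefficients, $H_q=\{x\in\mathbb{Z}_q^m : [a_1]_qx_1+\dots+[a_m]_qx_m=[b]_q\}$ is its reduction modulo $q$, with $\mathbb{Z}_q=\mathbb{Z}/q\mathbb{Z}$. For $H\in\mathcal{B}_m$, the restriction is $\mathcal{B}_m^H=\{H\cap H' : H'\in\mathcal{B}_m\setminus\{H\},\ H\cap H'\neq\emptyset\}$, and $|M((\mathcal{B}_m^H)_q)|$ denotes the number of points of $H_q$ not lying on any $H'_q$ with $H'\in\mathcal{B}_m\setminus\{H\}$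 (the characteristic quasi-polynomial of the restriction). When $i=1$ the odd-case expression is to be read as an algebraic expression (it equals $(q-2m)^{m-j+1}(q-2m+1)^{j-2}$). *)

(* Defs.v *)
From HB Require Import structures.
From mathcomp Require Import all_boot all_order all_algebra.

Set Implicit Arguments.
Unset Strict Implicit.
Unset Printing Implicit Defensive.

Import GRing.Theory.
Local Open Scope ring_scope.

(* (a, b) stands for the affine hyperplane a_1 x_1 + ... + a_m x_m = b.
   The reduction modulo q is a function of the integer equation, so hyperplanes
   are represented by equations rather than by subsets of R^m. *)
Definition hyperplane (m : nat) : Type := ('rV[int]_m * int)%type.

HB.instance Definition _ m := Equality.on (hyperplane m).

(* The linear form x_s, with s counted from 1 as in [m] = {1, ..., m}. *)
Definition xform (m s : nat) : 'rV[int]_m := \row_(k < m) (k.+1 == s)%:R.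

(* In every equation listed here the first nonzero coefficient is 1, hence
   distinct equations define distinct hyperplanes of R^m, and removing an
   equation from the list is the same as removing the hyperplane. *)
Definition shiB (m : nat) : seq (hyperplane m) :=
  let pairs :=
    [seq p <- [seq (s, t) | s <- iota 1 m, t <- iota 1 m] | (p.1 < p.2)%N] in
  [seq (xform m s, b) | s <- iota 1 m, b <- [:: 0; 1]]
  ++ [seq (xform m p.1 + xform m p.2, b) | p <- pairs, b <- [:: 0; 1]]
  ++ [seq (xform m p.1 - xform m p.2, b) | p <- pairs, b <- [:: 0; 1]].

(* 'Z_q is Z/qZ only for q >= 2. *)
Definition hyperplane_mod (m q : nat) (H : hyperplane m) : {set 'rV['Z_q]_m} :=
  [set x : 'rV['Z_q]_m |
    \sum_(k < m) (H.1 0 k)%:~R * x 0 k == H.2%:~R :> 'Z_q].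

(* M((A^H)_q) *)
Definition restriction_compl (m q : nat) (A : seq (hyperplane m))
    (H : hyperplane m) : {set 'rV['Z_q]_m} :=
  [set x in hyperplane_mod q H |
    all (fun H' => x \notin hyperplane_mod q H') [seq H' <- A | H' != H]].

(* Main.v *)
Require Import Defs.
From mathcomp Require Import all_boot all_order all_algebra.
From mathcomp Require Import zify ring.
From Stdlib Require Import FunctionalExtensionality.
Import GRing.Theory.

Set Implicit Arguments.
Unset Strict Implicit.
Unset Printing Implicit Defensive.

(** On the hyperplane x_i + x_j = 0 a point of the complement is a placement, on
    the half circle 1, ..., floor(q/2), of one signed letter for each index
    k <> j: k lies at x_k if its sign is + and at -x_k if its sign is -, and the
    letter of i also carries the letter of j with the opposite sign.  Order the
    signed indices as 1 < ... < m < -m < ... < -1.  The Shi equations say exactly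
    that letters in adjacent positions increase (all the indices of the first
    precede all those of the second), with conditions on the two ends of the half
    circle.  This order is transitive, so each maximal run of occupied positions is
    a chain, determined by its set of letters; a placement is thus the choice, for
    each letter, of a sign and of a block (a gap between empty positions), such
    that letters sharing a block are comparable.  Once sign and block of i are
    fixed, the other letters are chosen independently: k < i has q - 2m + 2
    choices, i < k < j has one fewer (not the block of i with the same sign), and
    k > j has two fewer.  For q odd one removes the placements in which the pair
    (-i, j) comes last on the half circle, next to its own mirror image. *)

(** * Placements and blocks *)

Section Blocks.
Variables (L : finType) (r : rel L).
Hypotheses (r_irr : irreflexive r) (r_trans : transitive r).
Implicit Types (b p : L -> nat) (s t u : L).

Definition ascending p := injective p /\ forall s t, p t = (p s).+1 -> r s t.
Definition block_chains b := forall s t, s != t -> b s = b t -> r s t || r t s.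
Definition before b : rel L := [rel s t | (b s < b t) || (b s == b t) && r s t].
(** The block number of a letter is the number of empty positions before it; adding the number of
    letters before it gives its position. [block] undoes this. *)
Definition pos b s := b s + #|[set t | before b t s]|.
Definition block p s := p s - #|[set t | p t < p s]|.

Lemma before_irr b : irreflexive (before b).
Proof. by move=> s; rewrite /before /= ltnn r_irr andbF. Qed.

Lemma before_trans b : transitive (before b).
Proof.
move=> t s u; rewrite /before /= => /orP[h1|/andP[/eqP h1 r1]] /orP[h2|/andP[/eqP h2 r2]].
- by rewrite (ltn_trans h1 h2).
- by rewrite -h2 h1.
- by rewrite h1 h2.
- by rewrite h1 h2 ltnn eqxx (r_trans r1 r2).
Qed.

Lemma before_total b s t :
  block_chains b -> s != t -> before b s t || before b t s.
Proof.
move=> ch st; rewrite /before /=.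
case: (ltngtP (b s) (b t)) => //= e.
by rewrite ch.
Qed.

Lemma before_pos b s t : before b s t -> pos b s < pos b t.
Proof.
move=> st; rewrite /pos -addnS leq_add //.
  by case/orP: st => [/ltnW|/andP[/eqP->]].
apply: proper_card; apply/properP; split.
  by apply/subsetP=> u; rewrite !inE => us; apply: before_trans us st.
by exists s; rewrite inE ?before_irr.
Qed.

Lemma pos_ltE b s t : block_chains b -> (pos b s < pos b t) = before b s t.
Proof.
move=> ch; apply/idP/idP; last exact: before_pos.
case: (eqVneq s t) => [->|/(before_total _)]; first by rewrite ltnn.
by case/(_ _ ch)/orP => // /before_pos h1 h2; move: (ltn_trans h1 h2); rewrite ltnn.
Qed.

Lemma pos_ascending b : block_chains b -> ascending (pos b).
Proof.
move=> ch; split=> [s t e | s t e].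
  case: (eqVneq s t) => // /before_total -/(_ _ ch).
  by case/orP=> /before_pos; rewrite e ltnn.
have : before b s t by rewrite -pos_ltE // e.
case/orP=> [lt|/andP[]] //.
have st : before b s t by rewrite /before /= lt.
(* If the block number rose from [s] to [t], the count of earlier letters would rise too, and the
   positions would differ by at least 2. *)
have : #|[set u | before b u s]| < #|[set u | before b u t]|.
  apply: proper_card; apply/properP; split; last by exists s; rewrite inE ?before_irr.
  by apply/subsetP=> u; rewrite !inE => us; apply: before_trans us st.
by move: e lt; rewrite /pos; lia.
Qed.

Lemma block_pos b s : block_chains b -> block (pos b) s = b s.
Proof.
move=> ch; rewrite /block (eq_card (B := mem [set t | before b t s])) ?addnK //.
by move=> t; rewrite !inE pos_ltE.
Qed.

Lemma pos_lt b c s : (forall s, b s <= c) -> pos b s < c + #|L|.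
Proof.
move=> bc; rewrite /pos -addnS leq_add //.
rewrite -cardsT; apply: proper_card; apply/properP; split; first exact: subsetT.
by exists s; rewrite inE ?before_irr.
Qed.

Lemma pos_eq0 b s : pos b s = 0 -> b s = 0 /\ forall t, ~~ before b t s.
Proof.
move/eqP; rewrite addn_eq0 cards_eq0 => /andP[/eqP-> /eqP e]; split=> // t.
by apply/negP=> ts; have := in_set0 t; rewrite -e inE ts.
Qed.

(** Both summands of [pos] are bounded, the block by [c] and the number of earlier letters by
    [#|L| - 1], so the top position forces both to be maximal. *)
Lemma pos_last b c s : block_chains b -> (forall s, b s <= c) ->
  (pos b s).+1 = c + #|L| <-> b s = c /\ forall t, ~~ before b s t.
Proof.
move=> ch bc.
have sub : [set t | before b t s] \subset [set~ s].
  by apply/subsetP=> t; rewrite !inE; apply: contraTneq => ->; rewrite before_irr.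
have cn : #|[set~ s]|.+1 = #|L| by rewrite cardsC1 prednK //; apply/card_gt0P; exists s.
have le := subset_leq_card sub; have bs := bc s.
split=> [e | [e nb]].
  have [e1 e2] : b s = c /\ #|[set~ s]| <= #|[set t | before b t s]|.
    by move: e; rewrite /pos; lia.
  split=> // t; apply/negP => st.
  have /eqP e3 : [set t | before b t s] == [set~ s] by rewrite eqEcard sub.
  have : t \in [set~ s] by rewrite !inE; apply: contraTneq st => ->; rewrite before_irr.
  by rewrite -e3 inE => ts; have := before_trans st ts; rewrite before_irr.
rewrite /pos e -cn addnS; suff -> : [set t | before b t s] = [set~ s] by [].
apply/eqP; rewrite eqEsubset sub; apply/subsetP=> t; rewrite !inE => ts.
by case/orP: (before_total ch ts) => // h; have := nb t; rewrite h.
Qed.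

(** If block 0 is nonempty, its first letter sits at position 0 and the others follow it in the
    chain. An upward closed condition at position 0 thus spreads to the whole block. *)
Lemma block0_upclosed b (P : pred L) : block_chains b ->
  (forall s t, r s t -> P s -> P t) ->
  (forall s, pos b s = 0 -> P s) -> forall s, b s = 0 -> P s.
Proof.
move=> ch up h s bs.
case: (arg_minnP (P := predT) (i0 := s) (pos b)) => // t _ tmin.
have nb u : ~~ before b u t by rewrite -pos_ltE // -leqNgt tmin.
have bt : b t = 0.
  by have := nb s; rewrite /before /= bs; case: (b t).
have Pt : P t.
  apply: h; rewrite /pos bt; apply/eqP; rewrite cards_eq0; apply/eqP/setP=> u.
  by rewrite !inE (negbTE (nb u)).
case: (eqVneq t s) => [<- //|ts].
case/orP: (ch t s ts (etrans bt (esym bs))) => rr; first exact: up rr Pt.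
by have := nb s; rewrite /before /= bs bt rr eqxx orbT.
Qed.

Lemma block_last_downclosed b c (P : pred L) :
  block_chains b -> (forall s, b s <= c) ->
  (forall s t, r s t -> P t -> P s) ->
  (forall s, (pos b s).+1 = c + #|L| -> P s) -> forall s, b s = c -> P s.
Proof.
move=> ch bc down h s bs.
case: (arg_maxnP (P := predT) (i0 := s) (pos b)) => // t _ tmax.
have nb u : ~~ before b t u by rewrite -pos_ltE // -leqNgt; exact: tmax.
have bt : b t = c.
  apply/eqP; rewrite eqn_leq bc /=.
  by have := nb s; rewrite /before /= bs negb_or -leqNgt => /andP[].
have Pt : P t by apply: h; apply/pos_last.
case: (eqVneq t s) => [<- //|ts].
case/orP: (ch t s ts (etrans bt (esym bs))) => rr; last exact: down rr Pt.
by have := nb s; rewrite /before /= bs bt rr eqxx orbT.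
Qed.

Section BlockOfPosition.
Variable p : L -> nat.
Hypothesis p_asc : ascending p.

Let C a := #|[set t | p t < a]|.

Lemma count_ltS a : (C a.+1 = C a /\ forall u, p u != a) \/
  C a.+1 = (C a).+1 /\ exists u, p u = a.
Proof.
case: (pickP (fun u => p u == a)) => [u /eqP pu | no]; [right|left].
  split; last by exists u.
  rewrite /C (_ : [set t | p t < a.+1] = u |: [set t | p t < a]).
    by rewrite cardsU1 inE pu ltnn.
  apply/setP=> t; rewrite !inE ltnS leq_eqVlt -pu; congr (_ || _).
  by apply/eqP/eqP=> [/(proj1 p_asc)|->].
split; last by move=> u; rewrite no.
by apply: eq_card => t; rewrite !inE ltnS leq_eqVlt no.
Qed.

Lemma count_ltD a c : C (a + c) <= C a + c.
Proof.
elim: c => [|c ih]; first by rewrite !addn0.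
rewrite !addnS; case: (count_ltS (a + c)) => [[-> _]|[-> _]]; lia.
Qed.

Lemma count_le a : C a <= a.
Proof.
have := count_ltD 0 a; rewrite add0n {2}/C (_ : [set t | p t < 0] = set0) ?cards0 //.
Qed.

Lemma blockK s : block p s + C (p s) = p s.
Proof. by rewrite subnK // count_le. Qed.

Lemma block_mono s t : p s <= p t -> block p s <= block p t.
Proof.
move=> st; have := blockK s; have := blockK t.
have := count_ltD (p s) (p t - p s); rewrite subnKC //; lia.
Qed.

(** Equal block numbers leave no empty position between [s] and [t], so adjacent letters link them
    by transitivity; the induction passes through the letter [u] just before [t]. *)
Lemma block_eq_lt s t : p s < p t -> block p s = block p t -> r s t.
Proof.
move pt: (p t) => a; elim: a t pt => // a ih t pt st e.
have bs := blockK s; have bt := blockK t; rewrite pt in bt.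
case: (ltngtP (p s) a) => [sa|sa|sa]; [|lia|]; last first.
  by apply: (proj2 p_asc); rewrite pt sa.
have := count_ltD (p s) (a - p s); rewrite subnKC ?(ltnW sa) // => le.
case: (count_ltS a) => [[h _]|[h [u pu]]]; first lia.
have bu := blockK u; rewrite pu in bu.
apply: (@r_trans u); last by apply: (proj2 p_asc); rewrite pt pu.
by apply: ih; rewrite ?pu //; lia.
Qed.

Lemma block_chainsP : block_chains (block p).
Proof.
move=> s t st e; case: (ltngtP (p s) (p t)) => [lt|lt|/(proj1 p_asc) eq].
- by rewrite block_eq_lt.
- by rewrite (block_eq_lt lt) ?orbT.
- by rewrite eq eqxx in st.
Qed.

Lemma pos_block s : pos (block p) s = p s.
Proof.
rewrite -[RHS]blockK /pos; congr (_ + _); apply: eq_card => t; rewrite !inE /before /=.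
case: (ltngtP (p t) (p s)) => [lt|lt|/(proj1 p_asc) ->]; last by rewrite ltnn r_irr andbF.
  case: ltngtP (block_mono (ltnW lt)) => //= e _.
  by rewrite block_eq_lt.
case: ltngtP (block_mono (ltnW lt)) => //= e _.
apply/negP=> rr; have := r_trans rr (block_eq_lt lt (esym e)); by rewrite r_irr.
Qed.

(** All letters lie among the first [c + #|L|] positions, so exactly [c] of these are empty. *)
Lemma block_le c s : (forall s, p s < c + #|L|) -> block p s <= c.
Proof.
move=> ph; have := blockK s; have := count_ltD (p s) (c + #|L| - p s).
rewrite subnKC ?(ltnW (ph s)) //.
have -> : C (c + #|L|) = #|L| by rewrite -[RHS]cardsT; apply: eq_card => t; rewrite !inE ph.
by have := ph s; lia.
Qed.

End BlockOfPosition.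
End Blocks.

(** * Counting functions that avoid given values *)

Lemma card_notin (D : finType) (r : seq D) : uniq r ->
  #|[pred y | y \notin r]| = #|D| - size r.
Proof.
move=> /card_uniqP <-; rewrite -(cardC (mem r)) addKn.
by apply: eq_card => y; rewrite !inE.
Qed.

Lemma card_ffun_avoid (T D : finType) (s0 : T) (y0 : D) (r : T -> seq D) :
  (forall s, s != s0 -> uniq (r s)) ->
  #|[set g : {ffun T -> D} |
      (g s0 == y0) && [forall s, (s != s0) ==> (g s \notin r s)]]|
  = \prod_(s | s != s0) (#|D| - size (r s)).
Proof.
move=> ur; pose F s := [pred y | if s == s0 then y == y0 else y \notin r s].
have -> : #|[set g : {ffun T -> D} |
      (g s0 == y0) && [forall s, (s != s0) ==> (g s \notin r s)]]| = #|family F|.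
  apply: eq_card => g; rewrite !inE; apply/andP/familyP => [[/eqP g0 /forallP gr] s|gF].
    rewrite inE; case: (eqVneq s s0) => [->|ss]; first by rewrite g0 /= eqxx.
    by have := gr s; rewrite ss.
  split; first by have := gF s0; rewrite inE eqxx.
  by apply/forallP=> s; apply/implyP=> /negbTE ss; have := gF s; rewrite inE ss.
rewrite card_family foldrE big_map big_enum (bigD1 s0) //=.
rewrite (_ : #|F s0| = 1) ?mul1n; last first.
  by rewrite -(card1 y0); apply: eq_card => y; rewrite !inE eqxx.
by apply: eq_bigr => s /negbTE ss; rewrite -card_notin ?ur ?ss.
Qed.

Lemma prod_three_ranges m (i j : 'I_m) x y z : i < j ->
  \prod_(k < m | (k != j) && (k != i)) (if k < i then x else if k < j then y else z)
  = x ^ i * y ^ (j - i.+1) * z ^ (m - j.+1).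
Proof.
move=> ij; have jm := ltn_ord j.
(* The value 1 at the omitted indices i and j lets the product split there into plain intervals. *)
pose F k := if (k != j :> nat) && (k != i :> nat)
  then (if k < i then x else if k < j then y else z) else 1.
have constF u v n : (forall k, u <= k < v -> F k = n) -> \prod_(u <= k < v) F k = n ^ (v - u).
  by move=> Fn; rewrite -prod_nat_const_nat; apply: eq_big_nat.
rewrite big_mkcond /= -(big_mkord xpredT F).
rewrite (@big_cat_nat _ _ _ i) //= ?(ltnW (ltn_trans ij jm)) //.
rewrite [X in _ * X]big_ltn ?(ltn_trans ij jm) //.
rewrite [X in _ * (_ * X)](@big_cat_nat _ _ _ j) //= ?(ltnW jm) //.
rewrite [X in _ * (_ * (_ * X))]big_ltn //.
have -> : F i = 1 by rewrite /F eqxx andbF.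
have -> : F j = 1 by rewrite /F eqxx.
rewrite !mul1n (constF 0 i x) ?(constF i.+1 j y) ?(constF j.+1 m z) ?subn0 ?mulnA //.
all: by move=> k /andP[h1 h2]; rewrite /F; do !case: ifP; lia.
Qed.

Local Open Scope ring_scope.

(** * The restriction of the Shi arrangement *)

Lemma xform_entry m (k l : 'I_m) : xform m k.+1 0 l = (l == k)%:R.
Proof. by rewrite mxE eqSS. Qed.

Definition eval_form m q (x : 'rV['Z_q]_m) (a : 'rV[int]_m) : 'Z_q :=
  \sum_(k < m) (a 0 k)%:~R * x 0 k.

Lemma eval_formD m q (x : 'rV['Z_q]_m) a b :
  eval_form x (a + b) = eval_form x a + eval_form x b.
Proof.
by rewrite -big_split; apply: eq_bigr => k _; rewrite mxE intrD mulrDl.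
Qed.

Lemma eval_formN m q (x : 'rV['Z_q]_m) a : eval_form x (- a) = - eval_form x a.
Proof.
by rewrite -sumrN; apply: eq_bigr => k _; rewrite mxE mulrNz mulNr.
Qed.

Lemma eval_xform m q (x : 'rV['Z_q]_m) (s : 'I_m) :
  eval_form x (xform m s.+1) = x 0 s.
Proof.
rewrite /eval_form (bigD1 s) //= big1 ?addr0 => [|k ks]; rewrite xform_entry.
  by rewrite eqxx mul1r.
by rewrite (negbTE ks) mul0r.
Qed.

Lemma mem_shiB m (H : hyperplane m) : reflect
  (exists2 b : int, b \in [:: 0; 1] &
    (exists s : 'I_m, H = (xform m s.+1, b)) \/
    exists s t : 'I_m, (s < t)%N /\ (H = (xform m s.+1 + xform m t.+1, b) \/
       H = (xform m s.+1 - xform m t.+1, b)))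
  (H \in shiB m).
Proof.
have pairP (p : nat * nat) : reflect (exists s t : 'I_m, (s < t)%N /\ p = (s.+1, t.+1))
    (p \in [seq p <- [seq (s, t) | s <- iota 1 m, t <- iota 1 m] | (p.1 < p.2)%N]).
  rewrite mem_filter; apply: (iffP andP) => [[lt /allpairsP[[s t] /= [hs ht e]]]|].
    move: lt hs ht; rewrite e /= !mem_iota !add1n !ltnS => lt /andP[s0 sm] /andP[t0 tm].
    have hs : (s.-1 < m)%N by lia. have ht : (t.-1 < m)%N by lia.
    exists (Ordinal hs), (Ordinal ht) => /=; split; first lia.
    by rewrite !prednK.
  case=> s [t [lt ->]] /=; split=> //; apply/allpairsP; exists (s.+1, t.+1) => /=.
  by rewrite !mem_iota !add1n !ltnS !ltn_ord.
rewrite /shiB !mem_cat; apply: (iffP or3P).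
  case=> /allpairsP[[u b] /= [hu hb ->]]; exists b => //.
  - left; move: hu; rewrite mem_iota add1n ltnS => /andP[u0 um].
    have hs : (u.-1 < m)%N by lia.
    by exists (Ordinal hs); rewrite /= prednK.
  - by case/pairP: hu => s [t [lt ->]]; right; exists s, t; split=> //; left.
  - by case/pairP: hu => s [t [lt ->]]; right; exists s, t; split=> //; right.
case=> b hb [[s ->]|[s [t [lt [->|->]]]]].
- apply: Or31; apply/allpairsP; exists (s.+1, b) => /=.
  by rewrite mem_iota add1n !ltnS ltn_ord.
- apply: Or32; apply/allpairsP; exists ((s.+1, t.+1), b); split=> //.
  by apply/pairP; exists s, t.
- apply: Or33; apply/allpairsP; exists ((s.+1, t.+1), b); split=> //.
  by apply/pairP; exists s, t.
Qed.

(** Every other equation of the list differs from x_i + x_j = 0 in a coefficient or in the constant,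
    so only the condition x_i + x_j <> 0 is dropped. *)
Lemma mem_restriction_compl m q (i j : 'I_m) (x : 'rV['Z_q]_m) : (i < j)%N ->
  reflect [/\ x 0 i + x 0 j = 0,
    forall k, x 0 k != 0 /\ x 0 k != 1,
    forall k l : 'I_m, (k < l)%N -> x 0 k - x 0 l != 0 /\ x 0 k - x 0 l != 1 &
    forall k l : 'I_m, (k < l)%N -> ((k, l) != (i, j) -> x 0 k + x 0 l != 0) /\
      x 0 k + x 0 l != 1]
  (x \in restriction_compl q (shiB m) (xform m i.+1 + xform m j.+1, 0 : int)).
Proof.
move=> ij; pose H0 : hyperplane m := (xform m i.+1 + xform m j.+1, 0); rewrite -/H0.
have memH a b : (x \in hyperplane_mod q (a, b)) = (eval_form x a == b%:~R).
  by rewrite inE.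
have notin H : H \in shiB m -> H <> H0 -> 
   all (fun H' => x \notin hyperplane_mod q H') [seq H' <- shiB m | H' != H0] ->
   x \notin hyperplane_mod q H.
  move=> HB /eqP HH /allP; apply; by rewrite mem_filter HH.
have ji : (j == i) = false by apply/eqP => e; move: ij; rewrite e ltnn.
rewrite inE; apply: (iffP andP).
  case; rewrite memH eval_formD !eval_xform => /eqP -> all; split=> // [k|k l kl|k l kl].
  - have nk b : (xform m k.+1, b) <> H0.
      case=> /rowP e _; move: (e i) (e j); rewrite !mxE !eqSS eqxx.
      rewrite -!(inj_eq val_inj) /= in ji *; lia.
    have h b (hb : b \in [:: 0; 1]) : x 0 k != b%:~R.
      rewrite -(eval_xform x) -memH; apply: notin (nk b) all.
      by apply/mem_shiB; exists b => //; left; exists k.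
    by split; [apply: (h 0) | apply: (h 1)].
  - have nk b : (xform m k.+1 - xform m l.+1, b) <> H0.
      by case=> /rowP e _; move: (e l); rewrite !mxE !eqSS; lia.
    have h b (hb : b \in [:: 0; 1]) : x 0 k - x 0 l != b%:~R.
      rewrite -!(eval_xform x) -eval_formN -eval_formD -memH; apply: notin (nk b) all.
      by apply/mem_shiB; exists b => //; right; exists k, l; split=> //; right.
    by split; [apply: (h 0) | apply: (h 1)].
  - have h b (hb : b \in [:: 0; 1]) :
        (xform m k.+1 + xform m l.+1, b) <> H0 -> x 0 k + x 0 l != b%:~R.
      rewrite -!(eval_xform x) -eval_formD -memH => nk; apply: notin nk all.
      by apply/mem_shiB; exists b => //; right; exists k, l; split=> //; left.
    split; last by apply: (h 1) => // -[].
    move=> kl'; apply: (h 0) => // -[/rowP e]; case/eqP: kl'.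
    move: (e i) (e j); rewrite !mxE !eqSS.
    by move=> e1 e2; congr (_, _); apply: val_inj; move=> /=; lia.
case=> x0 x1 x2 x3; split; first by rewrite memH eval_formD !eval_xform x0.
apply/allP => H; rewrite mem_filter => /andP[HH /mem_shiB[b hb]].
have b01 : b = 0 \/ b = 1 by move: hb; rewrite !inE => /orP[] /eqP; auto.
move=> [[s eH]|[s [t [lt [eH|eH]]]]]; move: HH; rewrite eH memH.
- by rewrite eval_xform; case: (x1 s); case: b01 => ->.
- rewrite eval_formD !eval_xform => HH; have [h0 h1] := x3 _ _ lt.
  case: b01 HH => -> // HH; apply: h0; apply: contraNneq HH => -[-> ->]; exact: eqxx.
- by rewrite eval_formD eval_formN !eval_xform => _; have [] := x2 _ _ lt; case: b01 => ->.
Qed.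

(** Below 2q in absolute value the only multiples of q are 0, q and -q. Congruences between signed
    residues thus become linear integer conditions that [lia] decides. *)
Lemma intr_Zq_eq q (k l : int) : (1 < q)%N -> (`|k - l| < 2 * q)%N ->
  (k%:~R == l%:~R :> 'Z_q) = [|| k == l, k == l + q%:Z | k == l - q%:Z].
Proof.
move=> q1 kl; rewrite -subr_eq0 -intrB.
have natq n : ((n%:R : 'Z_q) == 0) = (q %| n)%N by rewrite -val_eqE /= val_Zp_nat.
have -> : ((k - l)%:~R == 0 :> 'Z_q) = (q %| `|k - l|)%N.
  rewrite -natq; case: (intP (k - l)) => [|n|n] //.
  by rewrite mulrNz oppr_eq0 abszN.
apply/idP/idP; last first.
  case/or3P=> /eqP ->; [rewrite subrr | rewrite addrAC subrr add0r | ];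
    rewrite ?dvdn0 ?dvdnn //.
  by rewrite addrAC subrr add0r abszN dvdnn.
case/dvdnP=> c e; have : (c < 2)%N by rewrite -(ltn_pmul2r (ltnW q1)) -e.
case: c e => [|[|c]] // e _; lia.
Qed.

Definition signed (e : bool) (a : nat) : int := if e then a.+1%:Z else - a.+1%:Z.

Lemma signedN e a : signed (~~ e) a = - signed e a.
Proof. by case: e; rewrite /signed ?opprK. Qed.

(** * Residues written as signed positions on the half circle *)

Section Signed.
Variable q : nat.
Hypothesis q_gt3 : (3 < q)%N.
Let q_gt1 : (1 < q)%N. Proof. exact: ltnW (ltnW q_gt3). Qed.

Local Notation "e %:q" := (e%:~R : 'Z_q) (at level 2, format "e %:q").

Lemma signed_neq0 e a : (a < q./2)%N -> (signed e a)%:q != 0.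
Proof. by move=> ah; rewrite -(mulr0z 1) intr_Zq_eq //; case: e; rewrite /signed; lia. Qed.

Lemma signed_eq1 e a : (a < q./2)%N -> ((signed e a)%:q == 1) = e && (a == 0%N).
Proof. by move=> ah; rewrite -(mulr1z 1) intr_Zq_eq //; case: e; rewrite /signed; lia. Qed.

Lemma signed_neq e f a b : (a < q./2)%N -> (b < q./2)%N ->
  ((signed e a)%:q - (signed f b)%:q != 0) && ((signed e a)%:q + (signed f b)%:q != 0)
  = (a != b).
Proof.
move=> ah bh; rewrite -(mulr0z 1) -intrB -intrD !intr_Zq_eq //; move: q_gt1 => *;
  case: e f => -[]; rewrite /signed; lia.
Qed.

(** When x_j = - x_i, the form x_i - x_j equals 2 x_i, which vanishes on the half circle only at
    q/2. *)
Lemma signed_double_neq0 e a : (a < q./2)%N ->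
  ((signed e a)%:q - (signed (~~ e) a)%:q != 0) = ~~ (~~ odd q && (a.+1 == q./2)).
Proof.
move=> ah; rewrite -(mulr0z 1) -intrB intr_Zq_eq //; case: e; rewrite /signed /=; lia.
Qed.

(** The solution of 2 x = 1 for q odd is x = -(q - 1)/2, the last position with sign -; this is the
    source of the correction term. *)
Lemma signed_double_neq1 e a : (a < q./2)%N ->
  ((signed e a)%:q - (signed (~~ e) a)%:q != 1) = ~~ [&& odd q, ~~ e & a.+1 == q./2].
Proof.
move=> ah; rewrite -(mulr1z 1) -intrB intr_Zq_eq //; case: e; rewrite /signed /=; lia.
Qed.

End Signed.

(* Position of the signed index +-(k + 1) in the order 1 < ... < m < -m < ... < -1. *)
Definition key m (k : nat) (e : bool) : nat := if e then k else (2 * m - k.+1)%N.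

(** For adjacent positions only the sign of the smaller index k matters: + if k comes first, - if it
    comes second. As the key of k lies outside those of l and -l, this is the comparison of keys.
    The two sign hypotheses fix the representative at q/2. *)
Lemma signed_pair q m (k l a b : nat) (e f : bool) : (3 < q)%N ->
  (k < l < m)%N -> (a < q./2)%N -> (b < q./2)%N -> a != b ->
  (~~ odd q -> a.+1 = q./2 -> e) -> (~~ odd q -> b.+1 = q./2 -> f) ->
  (((signed e a)%:~R - (signed f b)%:~R != 1 :> 'Z_q) &&
   ((signed e a)%:~R + (signed f b)%:~R != 1 :> 'Z_q)) =
  ((b == a.+1) ==> (key m k e < key m l f)%N) &&
  ((a == b.+1) ==> (key m l f < key m k e)%N).
Proof.
move=> q3 klm ah bh ab ce cf; have q1 : (1 < q)%N by lia.
rewrite -(mulr1z 1) -intrB -intrD !intr_Zq_eq //;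
  by move: ce cf; case: e f => -[]; rewrite /signed /key; lia.
Qed.

(** * Points of the restriction as admissible placements *)

Section ShiRestriction.
Variables (m q : nat) (i j : 'I_m).
Hypotheses (ij : (i < j)%N) (q_large : (2 * m + 4 <= q)%N).

Let q_gt3 : (3 < q)%N. Proof. lia. Qed.
Let ij_neq : i != j. Proof. by apply: contraTneq ij => ->; rewrite ltnn. Qed.

(* Positions and indices are shifted by one: position a stands for the residue a + 1,
   and k : 'I_m for the index k + 1.  The index j is dropped, since x_j = - x_i; the
   interval [key_lo, key_hi] spans the keys of all signed indices carried by a letter. *)
Definition letter := {k : 'I_m | k != j}.
Definition letter_i : letter := Sub i ij_neq.
(** The default value matters: it sends j to the letter of i. *)
Definition letter_of (k : 'I_m) : letter := insubd letter_i k.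

Definition key_lo (s : letter) (e : bool) : nat :=
  if val s == i then (if e then i : nat else j) else key m (val s) e.
Definition key_hi (s : letter) (e : bool) : nat :=
  if val s == i then (2 * m - (if e then j else i).+1)%N else key m (val s) e.

Implicit Types (e : letter -> bool) (p b : letter -> nat) (s t : letter) (k l : 'I_m).

Definition precedes e : rel letter := [rel s t | (key_hi s (e s) < key_lo t (e t))%N].

Definition sign e k := (k != j) == e (letter_of k).

Definition point e p : 'rV['Z_q]_m :=
  \row_k (signed (sign e k) (p (letter_of k)))%:~R.

(* For q odd, -i in the last position would give x_i - x_j = 1. *)
Definition last_ok s (d : bool) : bool :=
  if odd q then ~~ ((val s == i) && ~~ d) else (key_hi s d < m)%N.

(** The third clause is x_k <> 1: position 0 bears no index with sign +, hence never the letter of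
    i. For q even, the last clause forces sign + at q/2 and bars the letter of i, since x_i - x_j =
    0 there. *)
Definition admissible e p :=
  [/\ ascending (precedes e) p, forall s, (p s < q./2)%N,
      forall s, p s = 0%N -> (m <= key_lo s (e s))%N &
      forall s, (p s).+1 = q./2 -> last_ok s (e s)].

Lemma key_lo_hi s d : (key_lo s d <= key_hi s d)%N.
Proof.
rewrite /key_lo /key_hi; case: eqP => // _; have := ltn_ord i; have := ltn_ord j.
by case: d; lia.
Qed.

Lemma precedes_irr e : irreflexive (precedes e).
Proof. by move=> s; rewrite /precedes /= ltnNge key_lo_hi. Qed.

Lemma precedes_trans e : transitive (precedes e).
Proof.
move=> t s u; rewrite /precedes /= => h1 h2; apply: ltn_trans h1 _.
exact: leq_ltn_trans (key_lo_hi _ _) h2.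
Qed.

Lemma val_letter_of k : val (letter_of k) = if k == j then i else k.
Proof. by rewrite val_insubd; case: eqP. Qed.

Lemma letter_ofK s : letter_of (val s) = s.
Proof. by apply: val_inj; rewrite val_letter_of (negbTE (valP s)). Qed.

Lemma letter_of_i : letter_of i = letter_i.
Proof. by rewrite -[i]/(val letter_i) letter_ofK. Qed.

Lemma letter_of_j : letter_of j = letter_i.
Proof. by apply: val_inj; rewrite val_letter_of eqxx. Qed.

Lemma sign_val e s : sign e (val s) = e s.
Proof. by rewrite /sign letter_ofK (valP s). Qed.

Lemma sign_i e : sign e i = e letter_i.
Proof. by rewrite -[i]/(val letter_i) sign_val. Qed.

Lemma sign_j e : sign e j = ~~ e letter_i.
Proof. by rewrite /sign letter_of_j eqxx; case: (e _). Qed.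

Lemma letter_of_inj k l : (k < l)%N -> (k, l) != (i, j) -> letter_of k != letter_of l.
Proof.
move=> kl nij; rewrite -val_eqE !val_letter_of; move: nij; rewrite xpair_eqE.
case: (eqVneq l j) => [lj|_]; rewrite ?andbT.
  by move=> ki; case: (eqVneq k j) => // kj; move: kl; rewrite kj lj ltnn.
rewrite andbF => _; case: (eqVneq k j) => [kj|_]; rewrite -val_eqE /=; last lia.
by move: kl; rewrite kj; lia.
Qed.

Lemma key_lo_le e k : (key_lo (letter_of k) (e (letter_of k)) <= key m k (sign e k))%N.
Proof.
rewrite /key_lo /sign /key val_letter_of; have := ltn_ord i; have := ltn_ord j.
have [->|kj] := eqVneq k j; first by rewrite eqxx; case: (e _) => /=; lia.
by have [->|ki] := eqVneq k i; case: (e _) => /=; lia.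
Qed.

Lemma key_hi_ge e k : (key m k (sign e k) <= key_hi (letter_of k) (e (letter_of k)))%N.
Proof.
rewrite /key_hi /sign /key val_letter_of; have := ltn_ord i; have := ltn_ord j.
have [->|kj] := eqVneq k j; first by rewrite eqxx; case: (e _) => /=; lia.
by have [->|ki] := eqVneq k i; case: (e _) => /=; lia.
Qed.

(** With [key_lo_le] this makes [key_lo] the least key carried by a letter, so that [precedes]
    compares all signed indices of two letters. *)
Lemma key_loE e s : exists2 k, letter_of k = s & key_lo s (e s) = key m k (sign e k).
Proof.
case: (eqVneq (val s) i) => si; last first.
  by exists (val s); rewrite ?letter_ofK // sign_val /key_lo (negbTE si).
have -> : s = letter_i by apply: val_inj.
rewrite /key_lo eqxx; case ei: (e letter_i).
  by exists i; rewrite ?letter_of_i // sign_i ei.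
by exists j; rewrite ?letter_of_j // sign_j ei.
Qed.

Lemma key_hiE e s : exists2 k, letter_of k = s & key_hi s (e s) = key m k (sign e k).
Proof.
case: (eqVneq (val s) i) => si; last first.
  by exists (val s); rewrite ?letter_ofK // sign_val /key_hi (negbTE si).
have -> : s = letter_i by apply: val_inj.
rewrite /key_hi eqxx; case ei: (e letter_i).
  by exists j; rewrite ?letter_of_j // sign_j ei.
by exists i; rewrite ?letter_of_i // sign_i ei.
Qed.

Lemma key_ge k d : (m <= key m k d)%N = ~~ d.
Proof. by rewrite /key; case: d; have := ltn_ord k; lia. Qed.

(* At the middle position q/2, which exists for q even, the two signs give the same point. *)
Definition normalized e p := forall s, ~~ odd q -> (p s).+1 = q./2 -> e s.

Lemma admissible_normalized e p : admissible e p -> normalized e p.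
Proof.
case=> _ _ _ hl s oq /hl; rewrite /last_ok (negbTE oq).
have := key_hi_ge e (val s); rewrite letter_ofK sign_val => h1 h2.
by apply: contraTT (leq_ltn_trans h1 h2) => ne; rewrite -leqNgt key_ge.
Qed.

Lemma admissible_mid e p : admissible e p -> ~~ odd q -> (p letter_i).+1 <> q./2.
Proof.
case=> _ _ _ hl oq /hl; rewrite /last_ok (negbTE oq) /key_hi eqxx.
by have := ltn_ord i; have := ltn_ord j; case: (e _); lia.
Qed.

Lemma point_ij e p : point e p 0 i + point e p 0 j = 0.
Proof.
by rewrite !mxE letter_of_i letter_of_j sign_i sign_j signedN mulrNz subrr.
Qed.

Lemma point_mem e p : admissible e p ->
  point e p \in restriction_compl q (shiB m) (xform m i.+1 + xform m j.+1, 0 : int).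
Proof.
move=> ad; have norm := admissible_normalized ad; have mid := admissible_mid ad.
case: (ad) => -[pinj asc] ph p0 pl.
have nrm k : ~~ odd q -> (p (letter_of k)).+1 = q./2 -> sign e k.
  move=> oq ek; rewrite /sign (norm _ oq ek); apply/eqP.
  by apply: contra_not_neq (mid oq) => kj; rewrite -ek kj letter_of_j.
(* Pairs other than (i, j) sit on distinct letters, where [signed_pair] applies; the pair (i, j)
   shares a letter and is handled through 2 x_i. *)
have gen k l : (k < l)%N -> (k, l) != (i, j) ->
    [/\ point e p 0 k - point e p 0 l != 0, point e p 0 k - point e p 0 l != 1,
        point e p 0 k + point e p 0 l != 0 & point e p 0 k + point e p 0 l != 1].
  move=> kl nij; have lkl := letter_of_inj kl nij.
  have pkl : p (letter_of k) != p (letter_of l) by apply: contra_neq lkl => /pinj.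
  rewrite !mxE.
  have := signed_neq q_gt3 (sign e k) (sign e l) (ph (letter_of k)) (ph (letter_of l)).
  rewrite pkl => /andP[-> ->].
  have := @signed_pair q m k l (p (letter_of k)) (p (letter_of l)) (sign e k) (sign e l)
    q_gt3 _ (ph _) (ph _) pkl (nrm k) (nrm l).
  rewrite kl ltn_ord => /(_ isT); set keys := (X in _ = X) => h.
  suff hk : keys by move: h; rewrite hk => /andP[-> ->].
  apply/andP; split; apply/implyP => /eqP /asc lt;
    by apply: leq_ltn_trans (key_hi_ge _ _) (leq_trans lt (key_lo_le _ _)).
have ijE : point e p 0 j = (signed (~~ e letter_i) (p letter_i))%:~R.
  by rewrite mxE letter_of_j sign_j.
have iiE : point e p 0 i = (signed (e letter_i) (p letter_i))%:~R.
  by rewrite mxE letter_of_i sign_i.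
apply/mem_restriction_compl => //; split=> [|k|k l kl|k l kl].
- exact: point_ij.
- rewrite mxE signed_neq0 // signed_eq1 //; split=> //; apply/negP => /andP[sk /eqP /p0].
  by have := key_lo_le e k; have := key_ge k (sign e k); rewrite sk /=; lia.
- case: (eqVneq (k, l) (i, j)) => [[-> ->]|/(gen _ _ kl)[]//].
  rewrite iiE ijE signed_double_neq0 // signed_double_neq1 //; split.
    by apply/negP => /andP[oq /eqP]; apply: mid.
  apply/negP => /and3P[oq ei /eqP /pl]; by rewrite /last_ok oq eqxx ei.
case: (eqVneq (k, l) (i, j)) => [[-> ->]|/(gen _ _ kl)[]//].
by rewrite point_ij; split=> //; rewrite eq_sym oner_eq0.
Qed.

Lemma point_admissible e p : normalized e p -> (forall s, p s < q./2)%N ->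
  point e p \in restriction_compl q (shiB m) (xform m i.+1 + xform m j.+1, 0 : int) ->
  admissible e p.
Proof.
move=> norm ph /(mem_restriction_compl _ ij)[_ x1 x2 x3].
have [d0 d1] := x2 _ _ ij; move: d0 d1.
rewrite !mxE letter_of_i letter_of_j sign_i sign_j signed_double_neq0 // signed_double_neq1 //.
move=> mid dbl.
have nrm k : ~~ odd q -> (p (letter_of k)).+1 = q./2 -> sign e k.
  move=> oq ek; rewrite /sign (norm _ oq ek); apply/eqP.
  by apply: contraNneq mid => kj; rewrite oq -ek kj letter_of_j eqxx.
have gen k l : (k < l)%N -> (k, l) != (i, j) -> 
    p (letter_of k) != p (letter_of l) /\
  ((p (letter_of l) == (p (letter_of k)).+1) ==> (key m k (sign e k) < key m l (sign e l))%N) &&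
  ((p (letter_of k) == (p (letter_of l)).+1) ==> (key m l (sign e l) < key m k (sign e k))%N).
  move=> kl nij; have [y0 y1] := x2 _ _ kl; have [/(_ nij) y2 y3] := x3 _ _ kl.
  move: y0 y1 y2 y3; rewrite !mxE => y0 y1 y2 y3.
  have pkl : p (letter_of k) != p (letter_of l).
    by rewrite -(signed_neq q_gt3 (sign e k) (sign e l)) // y0 y2.
  split=> //; rewrite -(@signed_pair q) ?y1 ?y3 ?kl ?ltn_ord //; exact: nrm.
have gen2 k l : letter_of k != letter_of l -> 
    p (letter_of k) != p (letter_of l) /\
  ((p (letter_of l) == (p (letter_of k)).+1) -> (key m k (sign e k) < key m l (sign e l))%N).
  move=> kl; case: (ltngtP k l) => [lt|lt|/val_inj eq]; last by rewrite eq eqxx in kl.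
    have [|h1 /andP[/implyP h2 _]] := gen k l lt; last by split.
    by apply: contraNneq kl => -[-> ->]; rewrite letter_of_i letter_of_j.
  have [|h1 /andP[_ /implyP h2]] := gen l k lt; last by split; rewrite // eq_sym.
  by apply: contraNneq kl => -[-> ->]; rewrite letter_of_i letter_of_j.
split=> //.
- split=> [s t st|s t st].
    apply/eqP; apply: contra_eqT st => st.
    by have [] := gen2 (val s) (val t); rewrite !letter_ofK.
  have nst : s != t by apply: contra_eqN st => /eqP ->; rewrite eqn_leq ltnn andbF.
  rewrite /precedes /=; have [k ek ->] := key_hiE e s; have [l el ->] := key_loE e t.
  have [|_] := gen2 k l; rewrite ek el //; apply; exact/eqP.
- move=> s ps; have [k ek ->] := key_loE e s; rewrite key_ge.
  by have [_] := x1 k; rewrite mxE signed_eq1 // ek ps eqxx andbT.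
move=> s ps; rewrite /last_ok; case: ifP => oq.
  apply: contra dbl => /andP[/eqP si ei]; rewrite oq.
  have -> : letter_i = s by apply: val_inj.
  by rewrite ei ps eqxx.
move/negbT: oq => oq; have es := norm _ oq ps.
have si : val s != i.
  apply: contraNneq mid => si; have -> : letter_i = s by apply: val_inj.
  by rewrite oq ps eqxx.
by rewrite /key_hi (negbTE si) /key es ltn_ord.
Qed.

Lemma signed_surj (v : 'Z_q) : v != 0 ->
  exists d a, [/\ v = (signed d a)%:~R, (a < q./2)%N & ~~ odd q -> a.+1 = q./2 -> d].
Proof.
move=> v0; have q1 : (1 < q)%N by lia.
have vq : (val v < q)%N by rewrite -[X in (_ < X)%N](Zp_cast q1) ltn_ord.
have vE : v = (val v)%:R by rewrite natr_Zp.
have v1 : (0 < val v)%N by rewrite lt0n; apply: contraNneq v0 => e; rewrite vE e.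
(* The weak inequality gives q/2 the sign +. *)
case: (leqP (val v) q./2) => h.
  by exists true, (val v).-1; split; rewrite /signed ?prednK.
exists false, (q - val v).-1; split; [|lia|lia].
rewrite /signed prednK ?subn_gt0 // mulrNz -pmulrn natrB ?(ltnW vq) //.
by rewrite pchar_Zp // sub0r opprK.
Qed.

Lemma restriction_point x :
  x \in restriction_compl q (shiB m) (xform m i.+1 + xform m j.+1, 0 : int) ->
  exists e p, admissible e p /\ x = point e p.
Proof.
move=> xX; have /(mem_restriction_compl _ ij)[x0 x1 _ _] := xX.
have ch s : exists ea : bool * nat, [&& x 0 (val s) == (signed ea.1 ea.2)%:~R,
    (ea.2 < q./2)%N & [&& ~~ odd q & ea.2.+1 == q./2] ==> ea.1].
  have [d [a [-> ha hn]]] := signed_surj (proj1 (x1 (val s))).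
  exists (d, a); rewrite /= eqxx ha; apply/implyP=> /andP[oq /eqP]; exact: hn.
pose e s := (xchoose (ch s)).1; pose p s := (xchoose (ch s)).2.
have ep s : [/\ x 0 (val s) = (signed (e s) (p s))%:~R, (p s < q./2)%N
    & ~~ odd q -> (p s).+1 = q./2 -> e s].
  have /and3P[/eqP h1 h2 /implyP h3] := xchooseP (ch s); split=> // oq /eqP h.
  by apply: h3; apply/andP; split=> //; apply/eqP.
have xE : x = point e p.
  apply/rowP=> k; rewrite mxE; case: (eqVneq k j) => [->|kj]; last first.
    have [h _ _] := ep (letter_of k); move: h.
    by rewrite val_letter_of (negbTE kj) /sign kj => ->; case: (e _).
  rewrite sign_j signedN mulrNz letter_of_j; have [<- _ _] := ep letter_i.
  by apply/eqP; rewrite -addr_eq0 addrC x0.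
exists e, p; split=> //; apply: point_admissible; last by rewrite -xE.
  by move=> s oq; case: (ep s) => _ _; apply.
by move=> s; case: (ep s).
Qed.

Lemma point_inj e p e' p' : admissible e p -> admissible e' p' ->
  point e p = point e' p' -> forall s, e s = e' s /\ p s = p' s.
Proof.
move=> ad ad' /rowP pe s; move: (pe (val s)); rewrite !mxE !letter_ofK !sign_val => /eqP.
have n1 := @admissible_normalized _ _ ad s; have n2 := @admissible_normalized _ _ ad' s.
case: ad ad' => [_ /(_ s) h1 _ _] [_ /(_ s) h2 _ _].
rewrite intr_Zq_eq; [|lia|by case: (e s) (e' s) => -[]; rewrite /signed; lia].
by move: n1 n2; case: (e s) (e' s) => -[]; rewrite /signed; lia.
Qed.

(** The number of empty positions, m - 1 letters being placed on the half circle; blocks are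
    numbered from 0 to [c]. *)
Let c := (q./2 - m.-1)%N.

Lemma card_letter : #|{: letter}| = m.-1.
Proof. by rewrite card_sig (cardC1 j) card_ord. Qed.

Lemma half_blocks : q./2 = (c + #|{: letter}|)%N.
Proof. by rewrite card_letter /c subnK //; lia. Qed.

(** For q odd the last clause involves two letters: -i may lie in the last block if another letter
    follows it there. *)
Definition chain_blocks e b :=
  [/\ block_chains (precedes e) b, forall s, (b s <= c)%N,
      forall s, b s = 0%N -> (m <= key_lo s (e s))%N &
      if odd q then b letter_i = c -> ~~ e letter_i ->
          exists2 t, b t = c & precedes e letter_i t
      else forall s, b s = c -> (key_hi s (e s) < m)%N].

Lemma admissible_pos e b : chain_blocks e b -> admissible e (pos (precedes e) b).
Proof.
case=> ch bc b0 bl; have irr := @precedes_irr e; have tr := @precedes_trans e.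
split; first exact: pos_ascending.
- by move=> s; rewrite half_blocks pos_lt.
- by move=> s /pos_eq0[/b0].
move=> s; rewrite half_blocks => /(pos_last irr tr _ ch bc)[bs nb].
move: bl; rewrite /last_ok; case: ifP => _; last exact.
move=> bl; apply/negP=> /andP[/eqP si es].
have e_i : letter_i = s by apply: val_inj.
rewrite e_i in bl; have [t bt st] := bl bs es.
by have := nb t; rewrite /before /= bs bt st eqxx orbT.
Qed.

Lemma chain_blocks_block e p : admissible e p -> chain_blocks e (block p).
Proof.
case=> asc ph p0 pl; have irr := @precedes_irr e; have tr := @precedes_trans e.
have ch : block_chains (precedes e) (block p) by apply: block_chainsP.
have bc s : (block p s <= c)%N.
  by apply: (block_le asc) => t; rewrite -half_blocks.
have pb := pos_block irr tr asc.
split=> //.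
  apply: (@block0_upclosed _ _ irr tr _ (fun s => m <= key_lo s (e s))%N ch) => [s t|s].
    by rewrite /precedes /= => st ms; have := key_lo_hi s (e s); lia.
  by rewrite pb; apply: p0.
move: pl; rewrite /last_ok; case: ifP => oq pl.
  move=> bi ei; case: (pickP (fun t => (block p t == c) && precedes e letter_i t)) => [t|no].
    by case/andP=> /eqP; exists t.
  (* With no letter after it in the last block, the letter of i stands at the last position, where
     [last_ok] forbids -i. *)
  have /pl : (p letter_i).+1 = q./2.
    rewrite half_blocks -pb; apply/pos_last => //; split=> // t.
    rewrite /before /= bi negb_or -leqNgt bc /=; have := no t.
    by rewrite eq_sym => ->.
  by rewrite ei eqxx.
apply: (@block_last_downclosed _ _ irr tr _ _ (fun s => key_hi s (e s) < m)%N ch bc) => [s t|s].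
  by rewrite /precedes /= => st ms; have := key_lo_hi t (e t); lia.
by rewrite pb -half_blocks; apply: pl.
Qed.

(** * Finite configurations of signs and blocks *)

Local Notation config := {ffun letter -> bool * 'I_c.+1}.
Implicit Type g : config.

Definition config_sign g s := (g s).1.
Definition config_block g s : nat := (g s).2.

Definition config_chains g : bool :=
  [&& [forall s, forall t, (s != t) ==> (config_block g s == config_block g t) ==>
         precedes (config_sign g) s t || precedes (config_sign g) t s],
      [forall s, (config_block g s == 0%N) ==> (m <= key_lo s (config_sign g s))%N] &
      if odd q then (config_block g letter_i == c) && ~~ config_sign g letter_i ==>
        [exists t, (config_block g t == c) && precedes (config_sign g) letter_i t]
      else [forall s, (config_block g s == c) ==> (key_hi s (config_sign g s) < m)%N]].

Lemma config_chainsP g :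
  reflect (chain_blocks (config_sign g) (config_block g)) (config_chains g).
Proof.
apply: (iffP and3P) => [[/forallP h1 /forallP h2 h3]|[h1 h2 h3 h4]]; split.
- by move=> s t st e; have /forallP /(_ t) := h1 s; rewrite st e eqxx.
- by move=> s; rewrite -ltnS ltn_ord.
- by move=> s e; have := h2 s; rewrite e eqxx.
- move: h3; case: ifP => _ h3; last by move=> s e; have /forallP /(_ s) := h3; rewrite e eqxx.
  move=> e1 e2; move: h3; rewrite e1 e2 eqxx => /existsP[t /andP[/eqP]]; by exists t.
- apply/forallP=> s; apply/forallP=> t; apply/implyP=> st; apply/implyP=> /eqP; exact: h1.
- by apply/forallP=> s; apply/implyP=> /eqP; apply: h3.
move: h4; case: ifP => _ h4; last by apply/forallP=> s; apply/implyP=> /eqP; apply: h4.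
apply/implyP=> /andP[/eqP e1 e2]; apply/existsP; have [t e3 e4] := h4 e1 e2.
by exists t; rewrite e3 eqxx.
Qed.

(** The bijection [F] places each configuration by [pos]: [point_inj] recovers signs and positions,
    and [block] then recovers the blocks. *)
Lemma card_restriction_configs :
  #|restriction_compl q (shiB m) (xform m i.+1 + xform m j.+1, 0 : int)| =
  #|[set g | config_chains g]|.
Proof.
pose F g := point (config_sign g) (pos (precedes (config_sign g)) (config_block g)).
rewrite -(card_in_imset (f := F)); last first.
  move=> g g'; rewrite !inE => /config_chainsP cg /config_chainsP cg'.
  move/(point_inj (admissible_pos cg) (admissible_pos cg')) => eg.
  have es : config_sign g = config_sign g'.
    by apply: functional_extensionality => s; case: (eg s).
  case: cg cg' => ch _ _ _ [ch' _ _ _].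
  apply/ffunP=> s; rewrite [g s]surjective_pairing [g' s]surjective_pairing; congr (_, _).
    by rewrite -!/(config_sign _ s) es.
  apply: val_inj; rewrite /= -!/(config_block _ s).
  rewrite -(block_pos (@precedes_irr _) (@precedes_trans _) _ ch).
  rewrite -(block_pos (@precedes_irr _) (@precedes_trans _) _ ch').
  by congr block; apply: functional_extensionality => t; case: (eg t).
apply: eq_card => x; apply/idP/imsetP => [/restriction_point[e [p [ad ->]]]|[g]].
  have cb := chain_blocks_block ad.
  pose g : config := [ffun s => (e s, inord (block p s))].
  have se : config_sign g = e by apply: functional_extensionality => s; rewrite /config_sign ffunE.
  have sb : config_block g = block p.
    apply: functional_extensionality => s; rewrite /config_block ffunE /= inordK //.
    by case: cb => _ /(_ s); rewrite ltnS.
  exists g; first by rewrite inE; apply/config_chainsP; rewrite se sb.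
  rewrite /F se sb; congr point; apply: functional_extensionality => s.
  by case: ad => asc _ _ _; rewrite (pos_block (@precedes_irr e) (@precedes_trans e)).
by rewrite inE => /config_chainsP cg ->; apply: point_mem; apply: admissible_pos.
Qed.

(** * Counting block configurations *)

Lemma config_card : #|{: bool * 'I_c.+1}| = (2 * c.+1)%N.
Proof. by rewrite card_prod card_bool card_ord. Qed.

(** The blocks closed to the letter of i: carrying both a + and a -, it fails the end condition
    whatever its sign. *)
Definition first_or_last (y : bool * 'I_c.+1) : bool :=
  (y.2 == ord0) || ~~ odd q && (y.2 == ord_max).

(* The pairs (sign, block) that the letter k may not take when that of i takes y. *)
Definition conflicts (y : bool * 'I_c.+1) (k : nat) : seq (bool * 'I_c.+1) :=
  [:: (true, ord0)] ++ nseq (~~ odd q) (false, ord_max) ++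
  nseq (i <= k)%N y ++ nseq (j <= k)%N (~~ y.1, y.2).

Definition unconflicted := [set g : config | ~~ first_or_last (g letter_i) &&
  [forall s, (s != letter_i) ==> (g s \notin conflicts (g letter_i) (val s))]].

Let d := (q - 2 * m)%N.

(** As [y] avoids the blocks closed to i, its entries cannot coincide with the end entries. *)
Lemma uniq_conflicts y k : ~~ first_or_last y -> uniq (conflicts y k).
Proof.
case: y => e b; rewrite /first_or_last /conflicts -!val_eqE /=.
by case: (odd q) (i <= k)%N (j <= k)%N e => -[] [] []; rewrite /= ?inE ?xpair_eqE -?val_eqE /=; lia.
Qed.

Lemma c_double : (2 * c = d + 2 - odd q)%N.
Proof. rewrite /c /d; have := ltn_ord i; lia. Qed.

Lemma c_gt0 : (0 < c)%N.
Proof. have := c_double; have := ltn_ord i; rewrite /d; lia. Qed.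

(** Parity cancels: there are d + 4 pairs for q even and d + 3 for q odd, and the list has one more
    end entry exactly when q is even. *)
Lemma size_conflicts y k : k != i -> k != j ->
  (#|{: bool * 'I_c.+1}| - size (conflicts y k))%N =
  if (k < i)%N then d.+2 else if (k < j)%N then d.+1 else d.
Proof.
move=> ki kj; rewrite config_card /conflicts /= !size_cat !size_nseq.
have := c_double; have := c_gt0; move: ij ki kj.
by do !case: ifP; lia.
Qed.

Lemma prod_letters x y z :
  \prod_(s : letter | s != letter_i)
     (if (val s < i)%N then x else if (val s < j)%N then y else z)
  = (x ^ i * y ^ (j - i.+1) * z ^ (m - j.+1))%N.
Proof.
rewrite -prod_three_ranges // (big_sub_cond (predC1 j) (predC1 i)
  (fun k : 'I_m => if (k < i)%N then x else if (k < j)%N then y else z)).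
by apply: eq_bigl.
Qed.

Lemma card_unconflicted_fiber y : ~~ first_or_last y ->
  #|[set g in unconflicted | g letter_i == y]| =
  (d.+2 ^ i * d.+1 ^ (j - i.+1) * d ^ (m - j.+1))%N.
Proof.
move=> yv; rewrite -prod_letters.
rewrite (_ : [set g in unconflicted | g letter_i == y] =
  [set g : config | (g letter_i == y) &&
    [forall s, (s != letter_i) ==> (g s \notin conflicts y (val s))]]).
  rewrite card_ffun_avoid => [|s _]; last exact: uniq_conflicts.
  apply: eq_bigr => s si; rewrite size_conflicts //; exact: valP s.
apply/setP=> g; rewrite !inE andbC; case: eqP => //= ->; by rewrite yv.
Qed.

Lemma card_not_first_or_last : #|[pred y | ~~ first_or_last y]| = (d + odd q)%N.
Proof.
pose r : seq (bool * 'I_c.+1) := [:: (true, ord0); (false, ord0)] ++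
  (if odd q then [::] else [:: (true, ord_max); (false, ord_max)]).
have c0 := c_gt0; have cd := c_double.
transitivity #|[pred y | y \notin r]|.
  apply: eq_card => -[e b]; rewrite /r !inE /first_or_last.
  by case: ifP => oq; rewrite /= ?inE ?in_nil !xpair_eqE -!val_eqE /=; case: e => /=; lia.
rewrite (@card_notin _ r) ?config_card /r.
  by case: ifP => oq /=; move: cd; rewrite oq; lia.
by case: ifP => oq; rewrite /= ?inE ?xpair_eqE -?val_eqE /=; lia.
Qed.

Lemma card_unconflicted : #|unconflicted| =
  ((d + odd q) * (d.+2 ^ i * d.+1 ^ (j - i.+1) * d ^ (m - j.+1)))%N.
Proof.
rewrite -card_not_first_or_last -sum_nat_const -sum1_card.
rewrite (partition_big (fun g : config => g letter_i) (fun y => ~~ first_or_last y)) /=.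
  apply: eq_bigr => y yv; rewrite -(card_unconflicted_fiber yv) sum1dep_card.
  by apply: eq_card => g; rewrite !inE.
by move=> g; rewrite inE => /andP[].
Qed.

(* For q odd, the unconflicted configurations in which the pair (-i, j) ends the
   half circle. *)
Definition ends_in_pair := [set g : config | (g letter_i == (false, ord_max)) &&
  [forall s, (s != letter_i) ==>
     (g s \notin nseq (val s < i)%N (false, ord_max) ++ conflicts (false, ord_max) (val s))]].

(** The extra exclusion for k < i leaves d + 1 choices, as many as for i < k < j, so these two
    ranges merge into one power. *)
Lemma card_ends_in_pair : odd q ->
  #|ends_in_pair| = (d.+1 ^ j.-1 * d ^ (m - j.+1))%N.
Proof.
move=> oq; have c0 := c_gt0.
rewrite card_ffun_avoid => [|s _].
  rewrite -[j.-1](_ : i + (j - i.+1) = _)%N; last lia.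
  rewrite expnD -prod_letters; apply: eq_bigr => s si.
  have := size_conflicts (false, ord_max) si (valP s).
  by rewrite [size (nseq _ _ ++ _)]size_cat size_nseq subnDA subnAC => ->; do !case: ifP; lia.
have uc : uniq (conflicts (false, ord_max) (val s)).
  by apply: uniq_conflicts; rewrite /first_or_last oq -val_eqE /=; lia.
case si: (val s < i)%N; rewrite ?cat0s // [nseq _ _]/= cat1s cons_uniq uc andbT /conflicts oq.
by rewrite leqNgt si [(j <= _)%N]leqNgt (ltn_trans si ij).
Qed.

Lemma letter_neqE s : (s != letter_i) = (val s != i).
Proof. by rewrite -val_eqE. Qed.

Lemma key_comparable e s t : s != letter_i -> t != letter_i -> s != t ->
  precedes e s t || precedes e t s.
Proof.
rewrite !letter_neqE /precedes /key_hi /key_lo /= => /negbTE -> /negbTE -> st.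
have {}st : (val s != val t :> nat) by rewrite !(inj_eq val_inj).
move: st (ltn_ord (val s)) (ltn_ord (val t)); rewrite /key /=.
by case: (e s) (e t) => -[]; lia.
Qed.

Definition ends_ok s (y : bool * 'I_c.+1) : bool :=
  ((y.2 == ord0) ==> (m <= key_lo s y.1)%N) &&
  (~~ odd q ==> (y.2 == ord_max) ==> (key_hi s y.1 < m)%N).

Lemma ends_ok_i y : ends_ok letter_i y = ~~ first_or_last y.
Proof.
rewrite /ends_ok /first_or_last /key_lo /key_hi eqxx.
have := ltn_ord i; have := ltn_ord j.
by case: y.1; case: (odd q); case: (_ == _); case: (_ == _) => /=; lia.
Qed.

(** The keys of k and -k both lie outside the interval of the letter of i when k < i and both inside
    when k > j. For i < k < j only the one with the sign of i lies inside. Being inside means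
    incomparable. *)
Lemma notin_conflicts s y z : s != letter_i -> ~~ first_or_last y ->
  (z \notin conflicts y (val s)) = ends_ok s z &&
    ((z.2 == y.2) ==> (key_hi letter_i y.1 < key_lo s z.1)%N
                      || (key_hi s z.1 < key_lo letter_i y.1)%N).
Proof.
rewrite letter_neqE => si; have sj : val s != j := valP s.
rewrite /ends_ok /first_or_last /key_lo /key_hi eqxx (negbTE si).
have {}si : (val s != i :> nat) by rewrite (inj_eq val_inj).
have {}sj : (val s != j :> nat) by rewrite (inj_eq val_inj).
move: si sj ij (ltn_ord i) (ltn_ord j) (ltn_ord (val s)) c_gt0.
rewrite /conflicts /key !mem_cat !mem_nseq !inE !lt0b.
case: y z => [e a] [f b]; rewrite !xpair_eqE -!val_eqE /=.
by case: e; case: f; case: (odd q) => /=; lia.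
Qed.

(** The signed indices beyond -i are exactly the -k with k < i. *)
Lemma pair_end_precedes s z : s != letter_i ->
  (z \in nseq (val s < i)%N (false, ord_max : 'I_c.+1)) =
  (z.2 == ord_max) && (key_hi letter_i false < key_lo s z.1)%N.
Proof.
rewrite letter_neqE => si; rewrite /key_lo /key_hi eqxx (negbTE si) mem_nseq.
have := ltn_ord i; have := ltn_ord (val s); case: z => [f b].
by rewrite xpair_eqE -!val_eqE /key /=; case: f => /=; lia.
Qed.

(** Letters other than that of i are always comparable with each other, so the chain condition
    reduces to separate conditions on each letter against the letter of i. *)
Lemma config_chainsE g :
  config_chains g = (g \in unconflicted) && ~~ (odd q && (g \in ends_in_pair)).
Proof.
have endsE : [forall s, (config_block g s == 0%N) ==> (m <= key_lo s (config_sign g s))%N] &&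
    (~~ odd q ==> [forall s, (config_block g s == c) ==> (key_hi s (config_sign g s) < m)%N])
    = [forall s, ends_ok s (g s)].
  apply/andP/forallP => [[/forallP h1 h2] s|h].
    rewrite /ends_ok h1; apply/implyP=> oq; move: h2; rewrite oq => /forallP; exact.
  split; first by apply/forallP=> s; case/andP: (h s).
  by apply/implyP=> oq; apply/forallP=> s; case/andP: (h s); rewrite oq.
have unc : (g \in unconflicted) = [forall s, ends_ok s (g s)] &&
    [forall s, forall t, (s != t) ==> (config_block g s == config_block g t) ==>
         precedes (config_sign g) s t || precedes (config_sign g) t s].
  rewrite inE -ends_ok_i; apply/andP/andP => [[gi /forallP gs]|[/forallP ok /forallP ch]].
    have nf : ~~ first_or_last (g letter_i) by rewrite -ends_ok_i.
    have gs' s : s != letter_i -> ends_ok s (g s) /\ ((g s).2 = (g letter_i).2 ->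
       precedes (config_sign g) letter_i s || precedes (config_sign g) s letter_i).
      move=> si; have := gs s; rewrite si notin_conflicts // => /andP[-> /implyP h].
      by split=> // e; apply: h; rewrite e.
    split; first by apply/forallP=> s; case: (eqVneq s letter_i) => [->//|/gs'[]].
    apply/forallP=> s; apply/forallP=> t; apply/implyP=> st; apply/implyP=> /eqP e.
    case: (eqVneq s letter_i) => [es|si].
      rewrite es in st e *; rewrite eq_sym in st; apply: (proj2 (gs' _ st)).
      exact: val_inj.
    case: (eqVneq t letter_i) => [et|ti]; last exact: key_comparable.
    by rewrite et orbC; apply: (proj2 (gs' _ si)); apply: val_inj; rewrite -et.
  split=> //; apply/forallP=> s; apply/implyP=> si; rewrite notin_conflicts -?ends_ok_i //.
  rewrite ok; apply/implyP=> /eqP e; rewrite orbC.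
  have /forallP /(_ letter_i) := ch s; rewrite si /= => /implyP; apply.
  by rewrite /config_block e.
rewrite unc -endsE /config_chains.
case: ifP => oq /=; last by rewrite andbT andbC.
rewrite andbT andbA [X in X && _]andbC; apply: andb_id2l => allok.
have : g \in unconflicted by rewrite unc -endsE oq /= andbT.
rewrite !inE => /andP[gi /forallP gs].
(* The remaining clause for q odd bites only when -i is in the last block; it then fails exactly
   when no -k with k < i shares that block. *)
case: (eqVneq (g letter_i) (false, ord_max)) => [gmax|gmax] /=; last first.
  apply/implyP=> /andP[b1 b2]; case/negP: gmax; rewrite [g letter_i]surjective_pairing.
  by rewrite xpair_eqE eqbF_neg -val_eqE; apply/andP; split.
have -> : (config_block g letter_i == c) && ~~ config_sign g letter_i.
  by rewrite /config_block /config_sign gmax /= eqxx.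
rewrite /= negb_forall; apply/existsP/existsP => -[t].
  case/andP=> bt; rewrite /precedes /= {1}/config_sign gmax => lt.
  have ti : t != letter_i.
    by apply: contraTneq lt => ->; rewrite /config_sign gmax -leqNgt key_lo_hi.
  by exists t; rewrite ti /= negbK mem_cat pair_end_precedes // lt andbT -val_eqE /= bt.
rewrite negb_imply negbK mem_cat => /andP[ti].
rewrite pair_end_precedes // => /orP[/andP[bt lt]|].
  exists t; rewrite -val_eqE /= in bt.
  by rewrite /config_block bt /precedes /= {1}/config_sign gmax.
by have := gs t; rewrite ti gmax /= => /negbTE ->.
Qed.

(** The additive form avoids truncated subtraction; for q odd, [ends_in_pair] is a subset of
    [unconflicted]. *)
Lemma card_restriction_shiB :
  (#|restriction_compl q (shiB m) (xform m i.+1 + xform m j.+1, 0 : int)%R|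
    + odd q * (d.+1 ^ j.-1 * d ^ (m - j.+1)) =
  (d + odd q) * (d.+2 ^ i * d.+1 ^ (j - i.+1) * d ^ (m - j.+1)))%N.
Proof.
rewrite card_restriction_configs -card_unconflicted.
case: (boolP (odd q)) => oq; last first.
  by rewrite addn0; apply: eq_card => g; rewrite inE config_chainsE (negbTE oq) andbT.
rewrite mul1n -card_ends_in_pair //.
have sub : ends_in_pair \subset unconflicted.
  apply/subsetP=> g; rewrite !inE => /andP[/eqP -> /forallP gs].
  rewrite /first_or_last oq orbF -val_eqE /= -lt0n c_gt0.
  apply/forallP=> s; apply/implyP=> si; have /implyP/(_ si) := gs s.
  by rewrite mem_cat negb_or => /andP[].
rewrite (_ : [set g | config_chains g] = unconflicted :\: ends_in_pair).
  by rewrite cardsD (setIidPr sub) subnK // subset_leq_card.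
by apply/setP=> g; rewrite in_setD in_set config_chainsE oq andbC.
Qed.

End ShiRestriction.

(** * The characteristic quasi-polynomial *)

Theorem theorem7p1 (m i j : nat) (hi : (1 <= i)%N) (hij : (i < j)%N)
    (hjm : (j <= m)%N) :
  exists N : nat, forall q : nat, (N <= q)%N ->
    let d : rat := q%:R - (2 * m)%:R in
    (#|restriction_compl q (shiB m) (xform m i + xform m j, 0 : int)|)%:R =
      if odd q then
        d ^+ (m - j) * (d + 1) ^+ (j - i)
          * ((d + 2) ^+ (i - 1) - (d + 1) ^ (i%:Z - 2))
      else
        d ^+ (m - j + 1) * (d + 1) ^+ (j - i - 1) * (d + 2) ^+ (i - 1).
Proof.
exists (2 * m + 4)%N => q hq d.
case: i j hi hij hjm => [//|i] [//|j] _ hij hjm.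
have him : (i < m)%N by rewrite ltnS in hij; apply: ltn_trans hjm.
have := @card_restriction_shiB m q (Ordinal him) (Ordinal hjm) hij hq.
set X := #|_| => /=.
have -> : d = (q - 2 * m)%N%:R by rewrite /d natrB //; lia.
move: (q - 2 * m)%N => n {d} card.
have eD : (n%:R + 1 = n.+1%:R :> rat) by rewrite -natr1.
have eD2 : (n%:R + 2 = n.+2%:R :> rat) by rewrite -[n.+2]addn2 natrD.
rewrite eD eD2; have n0 : n.+1%:R != 0 :> rat by rewrite Num.Theory.pnatr_eq0.
case: ifP card => oq /=; rewrite ?mul1n ?mul0n ?addn0 ?addn1 => card.
  have {card} /(congr1 (fun x : rat => x - (n.+1 ^ j.-1 * n ^ (m - j.+1))%:R)) :
      (X + n.+1 ^ j.-1 * n ^ (m - j.+1))%:R = (n.+1 *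
        (n.+2 ^ i * n.+1 ^ (j - i.+1) * n ^ (m - j.+1)))%:R :> rat by rewrite card.
  rewrite natrD addrK => ->; rewrite !natrM !natrX subn1 /=.
  (* For the first index the exponent is -1, so the integer power is written as a quotient by the
     nonzero d + 1. *)
  have -> : n.+1%:R ^ (i.+1%:Z - 2) = n.+1%:R ^+ i / n.+1%:R :> rat.
    have -> : i.+1%:Z - 2 = i%:Z - 1 by lia.
    by rewrite expfzDr.
  have -> : (j.+1 - i.+1 = (j - i.+1).+1)%N by lia.
  have -> : (j.-1 = (j - i.+1) + i)%N by lia.
  by rewrite exprD !exprS; field; rewrite nat1r.
rewrite card !natrM !natrX !subn1 subSS -subnS exprS /=.
by ring.
Qed.
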